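(* Let $\kappa$ be an uncountable cardinal with $\kappa=\kappa^{<\kappa}$. Assume that $\kappa$ is not weakly compact, and let $A$ be a subset of ${}^\kappa\kappa$ with the $\kappa$-perfect set property. Then the following statements are equivalent. (1) The set $A$ contains a closed subset (of ${}^\kappa\kappa$) homeomorphic to ${}^\kappa\kappa$. (2) The set $A$ is not contained in a $\mathrm{K}_\kappa$ subset of ${}^\kappa\kappa$. (3) The set $A$ has cardinality greater than $\kappa$. In particular, the set $A$ satisfies the strong Hurewicz dichotomy.
   Context: ${}^\kappa\kappa$ is the set of all functions from $\kappa$ to $\kappa$ with the bounded topology, whose basic open sets are $N_s=\{x\in{}^\kappa\kappa \mid s\subseteq x\}$ for $s\in{}^{<\kappa}\kappa$ (functions from an ordinal ${<}\kappa$ into $\kappa$); ${}^\kappa 2$ carries the subspace topology. $A\subseteq{}^\kappa\kappa$ is $\kappa$-compact if every open cover of $A$ has a subcover of size less than $\kappa$, and $\mathrm{K}_\kappa$ if it is a union of $\kappa$-many $\kappa$-compact subsets of ${}^\kappa\kappa$. $A$ has the $\kappa$-perfect set property if either $A$ has cardinality at most $\kappa$, or else $A$ contains a closed subset of ${}^\kappa\kappa$ homeomorphic to ${}^\kappa 2$. $A$ satisfies the strong Hurewicz dichotomy if either $A$ is itself a $\mathrm{K}_\kappa$ subset of ${}^\kappa\kappa$, or else $A$ contains a closed subset of ${}^\kappa\kappa$ homeomorphic to ${}^\kappa\kappa$. *)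

(* Defs.v *)
From HB Require Import structures.
From mathcomp Require Import all_boot all_order.
From mathcomp Require Import boolp classical_sets functions cardinality wochoice.
From mathcomp Require Import topology.

Set Implicit Arguments.
Unset Strict Implicit.
Unset Printing Implicit Defensive.

Import Order.TTheory.

Local Open Scope order_scope.
Local Open Scope classical_set_scope.
Local Open Scope card_scope.

Definition card_lt {T U : Type} (A : set T) (B : set U) : Prop :=
  A #<= B /\ ~ (B #<= A).

(* A cardinal kappa is a type [K] carrying a well-order, all of whose proper
   initial segments have strictly smaller cardinality (an initial ordinal).
   The ordinals below kappa are then the elements [a] of [K], each being
   identified with the segment of its predecessors; the least element [\bot]
   is the ordinal 0, and requiring it only excludes the empty [K]. *)
Section Cardinal.
Context {d : Order.disp_t} (K : bOrderType d).

Definition is_cardinal : Prop :=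
  well_order (<=%O : rel K) /\
  forall a : K, card_lt [set x : K | x < a] [set: K].

Definition below (a : K) := {x : K | x < a}.

(* The set of functions from an ordinal below kappa into kappa. *)
Definition lt_seq := {a : K & below a -> K}.

(* kappa = kappa^{<kappa} *)
Definition eq_lt_power : Prop := [set: K] #= [set: lt_seq].

(* kappa is uncountable and kappa -> (kappa)^2_2; a colouring of the
   two-element subsets {x, y}, x < y, is given by its values [c x y]. *)
Definition weakly_compact : Prop :=
  ~ countable [set: K] /\
  forall c : K -> K -> bool, exists H : set K,
    H #= [set: K] /\
    exists i : bool, forall x y, H x -> H y -> x < y -> c x y = i.

Definition gBaire := K -> K.

Definition basic_nbhd (s : lt_seq) : set gBaire :=
  [set x | forall b : below (tag s), x (sval b) = tagged s b].

End Cardinal.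

Section BoundedTopology.
Context {d : Order.disp_t} (K : bOrderType d).

HB.instance Definition _ := gen_eqMixin (lt_seq K).
HB.instance Definition _ := gen_choiceMixin (lt_seq K).
HB.instance Definition _ := isPointed.Build (lt_seq K)
  (existT (fun a : K => below a -> K) \bot (fun=> \bot)).

HB.instance Definition _ := gen_eqMixin (gBaire K).
HB.instance Definition _ := gen_choiceMixin (gBaire K).

Let basic_nbhd_cover : \bigcup_(s in [set: lt_seq K]) basic_nbhd s = setT.
Proof.
apply/seteqP; split=> // x _.
by exists (existT (fun a : K => below a -> K) \bot (fun b => x (sval b))).
Qed.

Let basic_nbhd_join (s t : lt_seq K) (x : gBaire K) :
  [set: lt_seq K] s -> [set: lt_seq K] t -> basic_nbhd s x -> basic_nbhd t x ->
  exists u, [/\ [set: lt_seq K] u, basic_nbhd u x &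
                basic_nbhd u `<=` basic_nbhd s `&` basic_nbhd t].
Proof.
move=> _ _ sx tx.
have sub (u v : lt_seq K) : tag u <= tag v -> basic_nbhd u x ->
    basic_nbhd v x -> basic_nbhd v `<=` basic_nbhd u.
  move=> uv ux vx y vy [b bu]; rewrite -ux /=.
  have bv := lt_le_trans bu uv.
  by rewrite (vy (exist _ b bv)) -(vx (exist _ b bv)).
by have [st|/ltW ts] := leP (tag s) (tag t);
  [exists t | exists s]; split=> // z zu; split=> //; apply: (sub _ _ _ _ _ z zu).
Qed.

HB.instance Definition _ := isBaseTopological.Build (gBaire K)
  basic_nbhd_cover basic_nbhd_join.

(* ^kappa 2, where 2 = {0, 1} is a subset of kappa: 0 is [\bot] and 1 is the
   element whose only predecessor is 0. *)
Definition gCantor : set (gBaire K) :=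
  [set x | forall a : K, x a = \bot \/ forall b : K, b < x a <-> b = \bot].

Definition kappa_compact (A : set (gBaire K)) : Prop :=
  forall F : set (set (gBaire K)),
    (forall U, F U -> open U) -> A `<=` \bigcup_(U in F) U ->
    exists G : set (set (gBaire K)),
      [/\ G `<=` F, card_lt G [set: K] & A `<=` \bigcup_(U in G) U].

Definition K_kappa (A : set (gBaire K)) : Prop :=
  exists C : K -> set (gBaire K),
    (forall i, kappa_compact (C i)) /\ A = \bigcup_i C i.

End BoundedTopology.

Arguments gCantor {d} K _.

Definition homeomorphic (S T : topologicalType) : Prop :=
  exists (f : S -> T) (g : T -> S),
    [/\ continuous f, continuous g, cancel f g & cancel g f].

(* Sets coerce to their subtype [set_type], which carries the subset
   topology. *)
Definition contains_closed_copy (X Y : topologicalType) (A : set X) : Prop :=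
  exists C : set X, [/\ closed C, C `<=` A & homeomorphic C Y].

Section Dichotomies.
Context {d : Order.disp_t} {K : bOrderType d}.
Implicit Type A : set (gBaire K).

Definition perfect_set_property A : Prop :=
  A #<= [set: K] \/ contains_closed_copy (gCantor K) A.

Definition strong_Hurewicz_dichotomy A : Prop :=
  K_kappa A \/ contains_closed_copy (gBaire K) A.

End Dichotomies.

(* Main.v *)
Require Import Defs.
From mathcomp Require Import all_boot all_order.
From mathcomp Require Import boolp classical_sets functions cardinality.
From mathcomp Require Import topology.

(* If some colouring [c] of pairs has no homogeneous set of size kappa, then
   for [x : K -> bool] the set [branch c x], which is greedily made
   end-homogeneous with colours [x], is bounded in kappa. Hence it is determined
   by an initial segment of [x]; since every [a] lies on some branch, this
   yields a continuous map [p] from ^kappa 2 onto the discrete space kappa.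
   Viewing elements of ^kappa 2 as kappa x kappa matrices and applying [p] to
   each row gives a continuous map ^kappa 2 -> ^kappa kappa with a continuous
   section, so ^kappa 2 contains a closed copy of ^kappa kappa. Such a copy is
   not covered by kappa many kappa-compact sets: by regularity these are bounded
   in every coordinate, so one can diagonalize against them. *)

Set Implicit Arguments.
Unset Strict Implicit.
Unset Printing Implicit Defensive.

Import Order.TTheory.

Local Open Scope order_scope.
Local Open Scope classical_set_scope.
Local Open Scope card_scope.

Lemma card_le_injP {T U : Type} (A : set T) (B : set U) (u0 : U) :
  A #<= B <-> exists2 f : T -> U, set_fun A B f & set_inj A f.
Proof.
split=> [|[f fAB injf]]; last first.
  have [g] : $|{injfun A >-> B}| by apply/injfunPex; exists f.
  exact: inj_card_le.
elim/Ppointed: U => U in B u0 *; first by case: (no u0).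
by move=> /pcard_leP[f]; exists f; [exact: funS|exact: inj].
Qed.

(** * Regularity of kappa from kappa = kappa^{<kappa} *)

Section Regularity.
Context {d : Order.disp_t} {K : bOrderType d}.
Implicit Types (a b x y : K) (S : set K).

Definition strictly_bounded S := exists a, forall x, S x -> x < a.

Context (cardK : is_cardinal K) (uncountableK : ~ countable [set: K]).

Lemma min_exists S : S !=set0 -> exists2 a, S a & forall x, S x -> a <= x.
Proof.
case: cardK => wo _ [x Sx].
have [|a [[Sa amin] _]] := wo (fun y => y \in S).
  by exists x; rewrite unfold_in inE.
exists a; first by move: Sa; rewrite unfold_in inE.
by move=> y Sy; apply: amin; rewrite unfold_in inE.
Qed.

Lemma lt_wf : well_founded (fun x y : K => x < y).
Proof.
move=> x; apply: contrapT => nx.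
have [|a na amin] := @min_exists [set y | ~ Acc (fun x y => x < y) y].
  by exists x.
apply: na; constructor => y ya; apply: contrapT => ny.
by have := amin y ny; rewrite leNgt ya.
Qed.

Lemma not_card_le_segment a : ~ ([set: K] #<= [set x | x < a]).
Proof. by case: cardK => _ /(_ a)[]. Qed.

(** An infinite cardinal is a limit: were [a] the largest element, kappa would inject into the
    predecessors of [a]. *)
Lemma exists_gt a : exists b, a < b.
Proof.
apply: contrapT => /forallNP amax.
have lea x : x <= a by rewrite leNgt; apply/negP/amax.
have /infiniteP/(card_le_injP _ _ \bot)[u _ injuT] : infinite_set [set: K].
  by move=> /finite_set_countable.
have inju : injective u by move=> m n; apply: injuT; rewrite inE.
apply: (@not_card_le_segment a); apply/(card_le_injP _ _ \bot).
(* Hilbert's hotel: vacate [u 0] by shifting along [u], then swap it with [a]. *)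
pose s x := if pselect (exists n, u n = x) is left e
            then u (projT1 (cid e)).+1 else x.
have su n : s (u n) = u n.+1.
  rewrite /s; case: pselect => [e|[]]; last by exists n.
  by case: (cid e) => m /= /inju ->.
have snu x : ~ (exists n, u n = x) -> s x = x by rewrite /s; case: pselect.
have s0 x : s x <> u 0%N.
  have [[n <-]|nx] := pselect (exists n, u n = x).
    by rewrite su => /inju.
  by rewrite snu// => xu; apply: nx; exists 0%N.
have injs : injective s.
  move=> x y.
  have [[n <-]|nx] := pselect (exists n, u n = x);
  have [[m <-]|ny] := pselect (exists n, u n = y); rewrite ?su ?snu//.
  - by move=> /inju[->].
  - by move=> e; case: ny; exists n.+1.
  - by move=> e; case: nx; exists m.+1.
exists (fun x => if s x == a then u 0%N else s x).
  move=> x _ /=; rewrite lt_neqAle lea andbT.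
  case: ifPn => // /eqP sxa; apply/eqP => u0a.
  by apply: (s0 x); rewrite sxa u0a.
move=> x y _ _; case: ifPn => [/eqP sx|_]; case: ifPn => [/eqP sy|_].
- by move=> _; apply: injs; rewrite sx.
- by move=> /esym/s0.
- by move=> /s0.
- by move=> /injs.
Qed.

Lemma not_card_le_closed_segment a : ~ ([set: K] #<= [set x | x <= a]).
Proof.
have [b ab] := exists_gt a.
move=> /card_le_trans/(_ (subset_card_le _))/not_card_le_segment; apply.
by move=> /= x xa; exact: le_lt_trans xa ab.
Qed.

Context (powK : eq_lt_power K).

Lemma lt_seq_code :
  exists (code : lt_seq K -> K) (decode : K -> lt_seq K), cancel code decode.
Proof.
have /card_eqPle[_ /(card_le_injP _ _ \bot)[code _ injc]] := powK.
have injcode : injective code by move=> s t; apply: injc; rewrite inE.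
have /choice[decode decodeP] a : exists s, forall t, code t = a -> t = s.
  have [[t <-]|na] := pselect (exists t, code t = a).
    by exists t => u /injcode.
  by exists point => t ta; case: na; exists t.
by exists code, decode => s; rewrite -(decodeP (code s) s).
Qed.

Definition seq_val (s : lt_seq K) x : K :=
  if pselect (x < tag s) is left h then tagged s (exist _ x h) else \bot.

Lemma seq_val_existT (f : K -> K) a x :
  x < a ->
  seq_val (existT (fun a => below a -> K) a (fun b : below a => f (sval b))) x =
  f x.
Proof. by rewrite /seq_val /= => xa; case: pselect. Qed.

(* Koenig's diagonal argument: a cofinal map from [a] to kappa would yield
   more than kappa functions from [a] to kappa. *)
Lemma regular (f : K -> K) a : strictly_bounded (f @` [set x | x < a]).
Proof.
apply: contrapT => unb.
have cof b : exists2 x, x < a & b <= f x.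
  apply: contrapT => nb; apply: unb; exists b => _ [x xa <-].
  by rewrite ltNge; apply/negP => bx; apply: nb; exists x.
have [code [decode codeK]] := lt_seq_code.
(* [h x] avoids the value at [x] of every sequence with code at most [f x]; these values are too few
   to exhaust kappa. *)
have /choice[h hP] : forall x, exists y,
    forall b, b <= f x -> y <> seq_val (decode b) x.
  move=> x; apply: contrapT => /forallNP all_hit.
  apply: (@not_card_le_closed_segment (f x)).
  apply: card_le_trans (card_image_le (fun b => seq_val (decode b) x) _).
  apply: subset_card_le => y _; apply: contrapT => ny; apply: (all_hit y).
  by move=> b bx yb; apply: ny; exists b.
pose b := code
  (existT (fun a => below a -> K) a (fun x : below a => h (sval x))).
have [x xa bx] := cof b.
by apply: (hP x b bx); rewrite codeK seq_val_existT.
Qed.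

Lemma strictly_boundedU S T :
  strictly_bounded S -> strictly_bounded T -> strictly_bounded (S `|` T).
Proof.
move=> [a Sa] [b Tb]; exists (Order.max a b) => x [/Sa|/Tb] xlt;
by rewrite lt_max xlt ?orbT.
Qed.

(* Transfinite recursion enumerates [S] in increasing order. *)
Lemma unbounded_card_eq S : ~ strictly_bounded S -> S #= [set: K].
Proof.
move=> unb; apply/card_eqPle; split; first exact: card_leT.
have above (f : K -> K) a : exists s, S s /\ forall x, x < a -> f x < s.
  have [b fb] := regular f a.
  have [s Ss bs] : exists2 s, S s & b <= s.
    apply: contrapT => nb; apply: unb; exists b => x Sx.
    by rewrite ltNge; apply/negP => bx; apply: nb; exists x.
  by exists s; split=> // x xa; apply: lt_le_trans bs; apply: fb; exists x.
(* The recursion supplies values below [a] only; padding them with [\bot] makes [above]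
   applicable. *)
have above_dep a (r : forall x, x < a -> K) : exists s,
    S s /\ forall x (xa : x < a), r x xa < s.
  have [s [Ss rs]] := above
    (fun x => if pselect (x < a) is left xa then r x xa else \bot) a.
  exists s; split=> // x xa; have := rs x xa.
  by case: pselect => // h; rewrite (Prop_irrelevance h xa).
pose next a r := projT1 (cid (@above_dep a r)).
have nextP a r : S (next a r) /\ forall x (xa : x < a), r x xa < next a r.
  exact: projT2 (cid (@above_dep a r)).
pose e := Fix lt_wf (fun=> K) next.
have eE a : e a = next a (fun x _ => e x).
  rewrite /e Fix_eq// => x f g fg; suff -> : f = g by [].
  apply: functional_extensionality_dep => y.
  exact: functional_extensionality_dep.
have Se a : S (e a).
  by rewrite eE; case: (nextP a (fun x _ => e x)).
have elt x a : x < a -> e x < e a.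
  by rewrite [e a]eE; case: (nextP a (fun x _ => e x)) => _; apply.
apply/(card_le_injP _ _ \bot); exists e => // x y _ _ exy.
by apply: contrapT => /eqP; rewrite neq_lt => /orP[] /elt; rewrite exy ltxx.
Qed.

(** An unbounded image would have size kappa, more than [G] allows. *)
Lemma card_lt_image_bounded {T} (G : set T) (f : T -> K) :
  card_lt G [set: K] -> strictly_bounded (f @` G).
Proof.
case=> _ nKG; apply: contrapT => /unbounded_card_eq/card_eqPle[_ KG].
exact: nKG (card_le_trans KG (card_image_le _ _)).
Qed.

End Regularity.

(** * Branches of a colouring without large homogeneous sets *)

Section Partition.
Context {d : Order.disp_t} {K : bOrderType d}.
Implicit Types (a b : K) (c : K -> K -> bool) (x y : K -> bool).
Context (cardK : is_cardinal K) (uncountableK : ~ countable [set: K])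
  (powK : eq_lt_power K).

Definition agree {T} a (x y : K -> T) := forall b, b < a -> x b = y b.

(* Walking up kappa, [branch c x] collects every [a] whose colours towards the
   points [b] collected so far are those predicted by [x]. *)
Definition branch c x : set K :=
  Fix (lt_wf cardK) (fun=> Prop)
    (fun a in_branch => forall b (ba : b < a), in_branch b ba -> c b a = x b).

Lemma branchE c x a :
  branch c x a <-> forall b, b < a -> branch c x b -> c b a = x b.
Proof.
rewrite {1}/branch Fix_eq// => {}a f g fg; suff -> : f = g by [].
apply: functional_extensionality_dep => b; exact: functional_extensionality_dep.
Qed.

(** For [a < b] on the branch the colour is [x a], so the points of the branch with a fixed value of
    [x] are homogeneous. Both halves are therefore bounded. *)
Lemma branch_bounded c x :
  (forall (H : set K) (i : bool), ~ strictly_bounded H ->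
     exists a b, [/\ H a, H b, a < b & c a b <> i]) ->
  strictly_bounded (branch c x).
Proof.
move=> nohom.
have half i : strictly_bounded (branch c x `&` [set a | x a = i]).
  apply: contrapT => /(nohom _ i)[a [b [[ax xa] [bx _] ab]]]; apply.
  by rewrite (proj1 (branchE c x b) bx a ab ax).
have := strictly_boundedU (half true) (half false).
rewrite -setIUr (_ : _ `|` _ = setT) ?setIT// -subTset => a _ /=.
by case: (x a); [left|right].
Qed.

(** Membership in a branch consults the predictions only at earlier points of the branch, and these
    all lie below [g]. *)
Lemma branch_agree c x y g :
  (forall a, branch c x a -> a < g) -> agree g y x -> branch c y = branch c x.
Proof.
move=> xg yx; apply/seteqP.
suff eq a : branch c y a <-> branch c x a by split=> a /eq.
elim/(well_founded_ind (lt_wf cardK)): a => a IH.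
split=> /branchE bra; apply/branchE => b ba.
  move=> bx; rewrite -yx ?xg//; apply: bra => //; exact/IH.
by move=> /(IH _ ba) bx; rewrite yx ?xg//; exact: bra.
Qed.

Lemma branch_self c a : branch c (c^~ a) a.
Proof. by apply/branchE. Qed.

Lemma exists_locally_determined_surjection : ~ weakly_compact K ->
  exists (p : (K -> bool) -> K) (z : K -> K -> bool),
    (forall i, p (z i) = i) /\
    forall x, exists a, forall y, agree a y x -> p y = p x.
Proof.
move=> nwc.
have [c nohom] : exists c, forall (H : set K) (i : bool), ~ strictly_bounded H ->
     exists a b, [/\ H a, H b, a < b & c a b <> i].
  apply: contrapT => /forallNP hom; apply: nwc; split=> // c.
  apply: contrapT => nH; apply: (hom c) => H i unbH.
  apply: contrapT => nab; apply: nH; exists H.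
  split; first exact: unbounded_card_eq.
  exists i => a b Ha Hb ab; apply: contrapT => cab.
  by apply: nab; exists a, b.
have /choice[ub ubP] (S : set K) :
    exists a, strictly_bounded S -> forall s, S s -> s < a.
  by have [[a Sa]|nS] := pselect (strictly_bounded S); [exists a|exists \bot].
have branch_lt x a : branch c x a -> a < ub (branch c x).
  by apply: ubP; exact: branch_bounded.
(* Every [a] lies on the branch of [c^~ a], hence below the bound chosen for it; so kappa many
   bounds occur. *)
have : ~ strictly_bounded (range (ub \o branch c)).
  move=> [a rga]; have := rga _ (imageT (ub \o branch c) (c^~ a)).
  by rewrite /= ltNge ltW// branch_lt//; exact: branch_self.
move=> /(unbounded_card_eq cardK uncountableK powK)/card_eqPle[_].
move=> /(card_le_injP _ _ \bot)[e erg inje].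
have /choice[z zP] i : exists z, ub (branch c z) = e i.
  by have [z _ ze] := erg i I; exists z.
(* [q] is a left inverse of the injection [e], with default [\bot] off its range. *)
have /choice[q qP] v : exists j, forall i, e i = v -> j = i.
  have [[j <-]|nj] := pselect (exists i, e i = v).
    by exists j => i /inje ->//; rewrite inE.
  by exists \bot => i iv; case: nj; exists i.
exists (q \o ub \o branch c), z; split=> [i /=|x].
  by rewrite zP; exact: qP.
exists (ub (branch c x)) => y /branch_agree yx /=.
by rewrite yx// => a; exact: branch_lt.
Qed.

End Partition.

(** * Closed copies inside subspaces *)

Section Subtypes.
Context {X : topologicalType}.
Implicit Types (C : set X) (Y : topologicalType).

Lemma nbhs_set_typeP C (w : C) (U : set C) :
  nbhs w U <-> exists2 V : set X, nbhs (val w) V & forall v : C, V (val v) -> U v.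
Proof.
split=> [[_ [[V oV <-] /= Vw VU]]|[V nV VU]].
  by exists V; first exact: open_nbhs_nbhs.
have : nbhs w (set_val @^-1` V) by exact: (@initial_continuous C X set_val).
exact: filterS.
Qed.

Lemma continuous_val C : continuous (val : C -> X).
Proof. exact: (@initial_continuous C X set_val). Qed.

Lemma continuous_to_set_type Y C (f : Y -> C) :
  continuous (val \o f) -> continuous f.
Proof. exact: (@continuous_comp_initial C Y X set_val). Qed.

(** The copy is the range of [f], that is, the set of fixed points of [f \o g], which is closed in a
    Hausdorff space. *)
Lemma contains_closed_copy_section Y C (f : Y -> C) (g : C -> Y) :
  hausdorff_space X -> closed C -> continuous f -> continuous g ->
  cancel f g -> contains_closed_copy Y C.
Proof.
move=> hX clC cf cg fK.
pose D : set X := [set z | exists2 w : C, f (g w) = w & val w = z].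
have DC : D `<=` C by move=> _ [w _ <-]; exact: set_valP.
have clD : closed D.
  move=> z Dz; have Cz : C z.
    by apply: clC => V /Dz[v [Dv Vv]]; exists v; split=> //; exact: DC.
  pose w : C := SigSub (mem_set Cz).
  (* Given neighbourhoods of [f (g w)] and of [w], a fixed point close enough to [w] lies in both,
     so the two points cannot be separated. *)
  exists w => //; apply: val_inj; apply: hX => U V nU nV /=.
  have /nbhs_set_typeP[W nW WU] : nbhs w (g @^-1` (f @^-1` (val @^-1` U))).
    exact/cg/cf/continuous_val.
  have [_ [[v fgv <-] [Wv Vv]]] := Dz _ (filterI nW nV).
  by exists (val v); split=> //; rewrite -[in val v]fgv; exact: WU.
exists D; split=> //.
have Df y : D (val (f y)) by exists (f y); rewrite ?fK.
pose i (w : D) : C := SigSub (mem_set (DC _ (set_valP w))).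
have ci : continuous i by apply: continuous_to_set_type; exact: initial_continuous.
exists (g \o i), (fun y => SigSub (mem_set (Df y))); split.
- by move=> w; apply: continuous_comp; [exact: ci|exact: cg].
- apply: continuous_to_set_type => y.
  by apply: (continuous_comp (cf y)); exact: continuous_val.
- move=> w; apply: val_inj => /=; have [v fgv vw] := set_valP w.
  by rewrite (_ : i w = v) ?fgv//; apply: val_inj.
- move=> y /=; rewrite (_ : i _ = f y) ?fK//; exact: val_inj.
Qed.

End Subtypes.

(** * Neighbourhoods in the bounded topology *)

Section GBaire.
Context {d : Order.disp_t} {K : bOrderType d}.
Context (cardK : is_cardinal K) (uncountableK : ~ countable [set: K]).
Implicit Types x y : gBaire K.

Lemma open_basic_nbhd (s : lt_seq K) : open (basic_nbhd s).
Proof. by exists [set s] => //; rewrite bigcup_set1. Qed.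

Lemma nbhs_gBaireP x (U : set (gBaire K)) :
  nbhs x U <-> exists a, forall y, agree a y x -> U y.
Proof.
rewrite nbhsE; split=> [[_ [[D _ <-] [s Ds sx]] DU]|[a aU]].
  exists (tag s) => y yx; apply: DU; exists s => //.
  suff : basic_nbhd s y by [].
  have {}sx : basic_nbhd s x by [].
  by move=> b; rewrite yx ?sx//; exact: (svalP b).
pose s : lt_seq K := existT _ a (fun b => x (sval b)).
exists (basic_nbhd s) => [|y ys].
  by split; [exact: open_basic_nbhd|].
by apply: aU => b ba; have := ys (exist _ b ba).
Qed.

(** Every coordinate is locally constant, because no [a] is the largest element of kappa. *)
Lemma gBaire_hausdorff : hausdorff_space (gBaire K).
Proof.
move=> x y xy; apply: funext => a; have [b ab] := exists_gt cardK uncountableK a.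
have n (u : gBaire K) : nbhs u [set v | v a = u a].
  by apply/nbhs_gBaireP; exists b => v; exact.
by have [v [/= <- <-]] := xy _ _ (n x) (n y).
Qed.

End GBaire.

(** * Copies of ^kappa kappa, and unions of kappa-compact sets *)

Section Hurewicz.
Context {d : Order.disp_t} {K : bOrderType d}.
Context (cardK : is_cardinal K) (uncountableK : ~ countable [set: K]).
Context (powK : eq_lt_power K).
Implicit Types A B C : set (gBaire K).

(** [pair a b] is the code of a sequence with value [a] at [\bot] and [b] at all other places below
    its length. *)
Lemma pairing :
  exists (pair : K -> K -> K) (fst snd : K -> K),
    (forall a b, fst (pair a b) = a) /\ (forall a b, snd (pair a b) = b).
Proof.
have [code [decode codeK]] := lt_seq_code powK.
have [u u0] := exists_gt cardK uncountableK \bot.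
have [v uv] := exists_gt cardK uncountableK u.
pose s a b : lt_seq K :=
  existT _ v (fun x => if sval x == \bot then a else b).
have sE a b x : x < v -> seq_val (s a b) x = if x == \bot then a else b.
  exact: (seq_val_existT (fun x => if x == \bot then a else b)).
exists (fun a b => code (s a b)), (fun k => seq_val (decode k) \bot),
  (fun k => seq_val (decode k) u).
by split=> a b; rewrite codeK sE ?eqxx// ?(gt_eqF u0)// (lt_trans u0).
Qed.

Lemma exists_one : exists2 o : K, o <> \bot & forall b, b < o <-> b = \bot.
Proof.
have [u u0] := exists_gt cardK uncountableK \bot.
have [|o o0 omin] := @min_exists _ _ cardK [set x | \bot < x]; first by exists u.
exists o => [o_eq|b]; first by move: o0; rewrite /= o_eq ltxx.
split=> [bo|-> //]; apply: contrapT => /eqP; rewrite -lt0x => /omin.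
by rewrite leNgt bo.
Qed.

(* With [p] locally determined and [p (z i) = i], the map sending [x] to the
   matrix whose row [a] is [z (x a)] has the continuous left inverse applying
   [p] to every row. *)
Lemma gBaire_retract_gCantor : ~ weakly_compact K ->
  exists (f : gBaire K -> gCantor K) (g : gCantor K -> gBaire K),
    [/\ continuous f, continuous g & cancel f g].
Proof.
move=> nwc.
have [p [z [pz p_local]]] :=
  exists_locally_determined_surjection cardK uncountableK powK nwc.
have [pair [fst [snd [fstK sndK]]]] := pairing.
have [o o0 oP] := exists_one.
pose F (x : gBaire K) : gBaire K :=
  fun k => if z (x (fst k)) (snd k) then o else \bot.
have FP x : gCantor K (F x).
  by move=> a; rewrite /F; case: ifP => _; [right|left].
pose row (y : gBaire K) a b := y (pair a b) != \bot.
pose G (y : gBaire K) : gBaire K := fun a => p (row y a).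
exists (fun x => SigSub (mem_set (FP x))), (fun y => G (val y)); split.
- apply: continuous_to_set_type => x U /= /nbhs_gBaireP[a aU].
  (* Below [a], [F x] reads [x] only at the coordinates [fst k] with [k < a]. *)
  have [b fst_lt] := regular cardK uncountableK powK fst a.
  apply/nbhs_gBaireP; exists b => y yx; apply: aU => k ka /=.
  by rewrite /F yx//; apply: fst_lt; exists k.
- suff cG : continuous G.
    by move=> y; apply: (continuous_comp (@continuous_val _ _ y)); exact: cG.
  move=> y U /nbhs_gBaireP[a aU].
  (* The value of [p] on row [c] is settled by the entries at [pair c e] with [e < l c]; [m c]
     bounds these positions, and [b] bounds [m c] for all [c < a]. *)
  have /choice[l lP] c := p_local (row y c).
  have /choice[m mP] c := regular cardK uncountableK powK (pair c) (l c).
  have [b mb] := regular cardK uncountableK powK m a.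
  apply/nbhs_gBaireP; exists b => x xy; apply: aU => c ca.
  apply: lP => e ec; rewrite /row xy//.
  by apply: lt_trans (mb (m c) _); [apply: mP; exists e|exists c].
- move=> x; apply: funext => a; rewrite /G /= -[RHS]pz; congr p.
  apply: funext => b; rewrite /row /F fstK sndK.
  by case: ifP => _; [exact/eqP|rewrite eqxx].
Qed.

Lemma gCantor_copy_gBaire_copy A : ~ weakly_compact K ->
  contains_closed_copy (gCantor K) A -> contains_closed_copy (gBaire K) A.
Proof.
move=> /gBaire_retract_gCantor[f [g [cf cg fK]]].
move=> [C [clC CA [h [k [ch ck hK kK]]]]].
suff [D [clD DC DY]] : contains_closed_copy (gBaire K) C.
  by exists D; split=> //; exact: subset_trans DC CA.
apply: (@contains_closed_copy_section _ _ C (k \o f) (g \o h)) => //.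
- exact: gBaire_hausdorff.
- by move=> x; exact: continuous_comp (cf x) (ck _).
- by move=> x; exact: continuous_comp (ch x) (cg _).
- by move=> x /=; rewrite kK fK.
Qed.

(** Since [f w i] is locally constant in [w], open sets on which it is bounded cover [B]. The bounds
    belonging to a subcover of size less than kappa are bounded by regularity. *)
Lemma kappa_compact_bounded B C (f : C -> gBaire K) i :
  kappa_compact B -> closed C -> continuous f ->
  exists b, forall w : C, B (val w) -> f w i < b.
Proof.
move=> compB clC cf.
have [j ij] := exists_gt cardK uncountableK i.
pose P (U : set (gBaire K)) b := forall w : C, U (val w) -> f w i < b.
have [|x Bx|G [GF cardG BG]] := compB [set U | open U /\ exists b, P U b].
- by move=> U [].
- have [Cx|nCx] := pselect (C x); last first.
    (* Points of [B] outside [C] are covered by the complement of [C], where any bound holds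
       vacuously. *)
    exists (~` C) => //; split; first exact: closed_openC.
    by exists \bot => w; case; exact: set_valP.
  pose w : C := SigSub (mem_set Cx).
  have : nbhs w (f @^-1` [set y | y i = f w i]).
    by apply: cf; apply/nbhs_gBaireP; exists j => y; exact.
  move=> /nbhs_set_typeP[V]; rewrite nbhsE => -[W [oW Wx] WV] Vf.
  exists W => //; split=> //; have [b fb] := exists_gt cardK uncountableK (f w i).
  by exists b => v /WV/Vf /= ->.
have /choice[m mP] U : exists b, (exists c, P U c) -> P U b.
  by have [[b Pb]|nP] := pselect (exists c, P U c); [exists b|exists \bot].
have [b mb] := card_lt_image_bounded cardK uncountableK powK m cardG.
exists b => w /BG[U GU Uw]; have [_ /mP/(_ w Uw) fm] := GF U GU.
by apply: lt_trans fm (mb _ _); exists U.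
Qed.

(** Coordinate [i] stays below [b i] on the [i]-th compact set, so the point of the copy
    corresponding to [b] lies in none of them. *)
Lemma gBaire_copy_not_sub_K_kappa A : contains_closed_copy (gBaire K) A ->
  ~ exists B, K_kappa B /\ A `<=` B.
Proof.
move=> [C [clC CA [f [g [cf cg fK gK]]]]] [_ [[D [compD ->]] AD]].
have /choice[b bP] i := kappa_compact_bounded i (compD i) clC cf.
have [i _ Di] := AD _ (CA _ (set_valP (g b))).
by have := bP i _ Di; rewrite gK ltxx.
Qed.

(** The constant functions already provide kappa many points. *)
Lemma gBaire_copy_card A : contains_closed_copy (gBaire K) A ->
  [set: K] #<= A.
Proof.
move=> [C [_ CA [f [g [_ _ _ gK]]]]]; apply/card_le_injP; first exact: (fun=> \bot).
exists (fun i => val (g (fun=> i))) => [i _|i j _ _ /val_inj ij].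
  exact/CA/set_valP.
by have /(congr1 (@^~ \bot)) := congr1 f ij; rewrite !gK.
Qed.

Lemma kappa_compact_subsingleton B :
  (forall x y, B x -> B y -> x = y) -> kappa_compact B.
Proof.
move=> B1 F _ BF.
have [G GF [Gfin BG]] : exists2 G : set (set (gBaire K)), G `<=` F &
    finite_set G /\ B `<=` \bigcup_(U in G) U.
  have [[x Bx]|nB] := pselect (exists x, B x); last first.
    by exists set0 => //; split=> // x Bx; case: nB; exists x.
  have [U FU Ux] := BF x Bx.
  exists [set U] => [_ -> //|]; split; first exact: finite_set1.
  by move=> y By; rewrite (B1 y x)//; exists U.
exists G; split=> //; split.
  apply: card_le_trans (finite_set_countable Gfin) _.
  by apply/infiniteP => /finite_set_countable.
move=> KG; apply: uncountableK; apply: finite_set_countable.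
exact: card_le_finite KG Gfin.
Qed.

(** The fibres of an injection into kappa have at most one point each and are indexed by kappa. *)
Lemma card_le_K_kappa A : A #<= [set: K] -> K_kappa A.
Proof.
move=> /(card_le_injP _ _ \bot)[h _ injh].
exists (fun i => [set x | A x /\ h x = i]); split=> [i|].
  apply: kappa_compact_subsingleton => x y [Ax xi] [Ay yi].
  by apply: injh; rewrite ?inE// xi.
apply/seteqP; split=> [x Ax|x [i _ []]//]; by exists (h x).
Qed.

End Hurewicz.

Theorem proposition2p7 (d : Order.disp_t) (K : bOrderType d)
    (cardK : is_cardinal K) (uncountableK : ~ countable [set: K])
    (powK : eq_lt_power K) (nwcK : ~ weakly_compact K)
    (A : set (gBaire K)) (pspA : perfect_set_property A) :
  ((contains_closed_copy (gBaire K) A <->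
      ~ (exists B : set (gBaire K), K_kappa B /\ A `<=` B)) /\
   (~ (exists B : set (gBaire K), K_kappa B /\ A `<=` B) <->
      card_lt [set: K] A)) /\
  strong_Hurewicz_dichotomy A.
Proof.
(* The perfect set property gives a copy of ^kappa 2, in which a copy of ^kappa kappa is found. *)
have copyA : ~ (A #<= [set: K]) -> contains_closed_copy (gBaire K) A.
  by case: pspA => // cA _; exact: gCantor_copy_gBaire_copy.
have not_small : ~ (exists B, K_kappa B /\ A `<=` B) -> ~ (A #<= [set: K]).
  by move=> nB smallA; apply: nB; exists A; split=> //; exact: card_le_K_kappa.
have copy_not_sub := @gBaire_copy_not_sub_K_kappa _ _ cardK uncountableK powK A.
split; [split; split|].
- exact: copy_not_sub.
- by move=> /not_small/copyA.
- move=> /not_small nA; split=> //.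
  exact/gBaire_copy_card/copyA.
- by move=> [_ /copyA/copy_not_sub].
- have [smallA|/copyA] := pselect (A #<= [set: K]); last by right.
  by left; exact: card_le_K_kappa.
Qed.
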